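(* For all $n\ge3$, we have $c_n(123,132,213,231,312)=1$.
   Context: A word $\pi=\pi_1\dots\pi_m$ over the positive integers contains the pattern $\sigma=\sigma_1\dots\sigma_k$ if there are indices $1\le i_1<\dots<i_k\le m$ such that for all $r,s\in\{1,\dots,k\}$: $\pi_{i_r}<\pi_{i_s}$ iff $\sigma_r<\sigma_s$, and $\pi_{i_r}=\pi_{i_s}$ iff $\sigma_r=\sigma_s$; otherwise $\pi$ avoids $\sigma$. $\mathcal{C}_n$ denotes the set of nonnesting permutations: arrangements (words) of the multiset $\{1,1,2,2,\dots,n,n\}$ that avoid the patterns $1221$ and $2112$. For patterns $\sigma,\tau,\dots$, $c_n(\sigma,\tau,\dots)$ is the number of $\pi\in\mathcal{C}_n$ avoiding all of $\sigma,\tau,\dots$. *)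

(* Defs.v *)
From mathcomp Require Import all_boot.

Set Implicit Arguments.
Unset Strict Implicit.
Unset Printing Implicit Defensive.

(* Words and patterns are sequences of natural numbers; [f] lists the positions
   (numbered from 0) of an occurrence of [sigma] in [w]. *)
Definition contains (w sigma : seq nat) : bool :=
  [exists f : {ffun 'I_(size sigma) -> 'I_(size w)},
     [forall r : 'I_(size sigma), forall s : 'I_(size sigma),
        [&& (r < s) ==> (f r < f s),
            (nth 0 w (f r) < nth 0 w (f s)) == (nth 0 sigma r < nth 0 sigma s)
          & (nth 0 w (f r) == nth 0 w (f s)) ==
            (nth 0 sigma r == nth 0 sigma s)]]].

Definition avoids (w sigma : seq nat) : bool := ~~ contains w sigma.

(* The multiset {1,1,2,2,...,n,n}. *)
Definition double_multiset (n : nat) : seq nat :=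
  flatten [seq [:: i; i] | i <- iota 1 n].

(* [permutations s] is duplicate-free, even when [s] has repeated entries. *)
Definition nonnesting (n : nat) : seq (seq nat) :=
  [seq w <- permutations (double_multiset n)
     | avoids w [:: 1; 2; 2; 1] & avoids w [:: 2; 1; 1; 2]].

Definition c (n : nat) (patterns : seq (seq nat)) : nat :=
  count (fun w => all (avoids w) patterns) (nonnesting n).

(* Main.v *)
Require Import Defs.
From mathcomp Require Import all_boot.
From mathcomp Require Import zify.

(** The five patterns are exactly the permutations of length three that have
    an ascent, and the only word that survives is [n n ... 2 2 1 1].

    If a word has an adjacent ascent [a b], then, since [n >= 3], some value
    [x] other than [a] and [b] occurs elsewhere in it, hence before [a] or
    after [b]; so [x a b] or [a b x] is a subsequence of three distinct values
    with an ascent, an occurrence of one of the five patterns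
    ([ascent_extends_to_pattern]).  A word avoiding them is therefore weakly
    decreasing, and the multiset [{1,1,...,n,n}] has just one weakly decreasing
    arrangement.

    Conversely a weakly decreasing word contains only weakly decreasing
    patterns ([contains_nonincreasing]); none of the five is one, and neither
    are [1221] and [2112], so this arrangement is nonnesting and is counted. *)

(** The comparisons [<] in both directions also decide equality, so the clause
    of [contains] on equal entries comes for free. *)
Lemma subseq_contains (w v sigma : seq nat) :
    subseq v w -> size v = size sigma ->
    (forall r s, r < size sigma -> s < size sigma ->
       (nth 0 v r < nth 0 v s) = (nth 0 sigma r < nth 0 sigma s)) ->
  contains w sigma.
Proof.
case/subseqP=> m szm vE szv vsigma.
pose p := mask m (iota 0 (size w)).
have vp : v = map (nth 0 w) p by rewrite map_mask map_nth_iota0 // take_size.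
have szp : size p = size sigma by rewrite -szv vp size_map.
have p_lt : sorted ltn p.
  by apply: (subseq_sorted ltn_trans (mask_subseq _ _)); apply: iota_ltn_sorted.
have p_bound (r : 'I_(size sigma)) : nth 0 p r < size w.
  have : nth 0 p r \in iota 0 (size w).
    by apply: (mem_mask (m := m)); rewrite mem_nth // szp.
  by rewrite mem_iota.
apply/existsP; exists [ffun r => Ordinal (p_bound r)].
apply/forallP=> r; apply/forallP=> s; rewrite !ffunE /=.
have nth_p (t : 'I_(size sigma)) : nth 0 w (nth 0 p t) = nth 0 v t.
  by rewrite vp (nth_map 0) // szp.
have eqnE (x y : nat) : (x == y) = ~~ (x < y) && ~~ (y < x) by lia.
rewrite !nth_p ![nth _ _ _ == nth _ _ _]eqnE !vsigma // !eqxx !andbT.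
by apply/implyP=> rs; apply: (sorted_ltn_nth ltn_trans) => //; rewrite inE szp.
Qed.

Lemma geq_trans : transitive geq.
Proof. by move=> y x z /= yx zy; apply: leq_trans zy yx. Qed.

(** Entries of the pattern compare as entries of the word do, so an ascent of
    the pattern would be an ascent of the word. *)
Lemma contains_nonincreasing (w sigma : seq nat) :
  sorted geq w -> contains w sigma -> sorted geq sigma.
Proof.
move=> w_geq /existsP[f /forallP fP].
apply/(sortedP 0) => i lti.
have /forallP/(_ (Ordinal lti))/and3P[/= /implyP/(_ (leqnn _)) f_lt /eqP fE _]
  := fP (Ordinal (ltnW lti)).
rewrite leqNgt -fE -leqNgt.
by apply: (sorted_ltn_nth geq_trans 0 w_geq) => //; rewrite inE.
Qed.

Definition ascent_patterns : seq (seq nat) :=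
  [:: [:: 1; 2; 3]; [:: 1; 3; 2]; [:: 2; 1; 3]; [:: 2; 3; 1]; [:: 3; 1; 2]].

(** Wherever the third value [x] falls relative to [a < b], and on whichever
    side of them it sits, the pattern formed keeps the ascent. *)
Lemma ascent_extends_to_pattern (w1 w2 : seq nat) (a b x : nat) :
    a < b -> x != a -> x != b -> x \in w1 ++ w2 ->
  has (contains (w1 ++ a :: b :: w2)) ascent_patterns.
Proof.
move=> ab xa xb; rewrite mem_cat => /orP[xw | xw]; apply/hasP.
- have sub : subseq [:: x; a; b] (w1 ++ a :: b :: w2).
    apply: (@cat_subseq _ [:: x] [:: a; b]); first by rewrite sub1seq.
    exact: prefix_subseq [:: a; b] w2.
  have [xlta | ax] := ltnP x a; [exists [:: 1; 2; 3] => //|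
    have [xltb | bx] := ltnP x b; [exists [:: 2; 1; 3] => //|
                                   exists [:: 3; 1; 2] => //]];
  by apply: (subseq_contains _ _ _ sub) => // - [|[|[|r]]] [|[|[|s]]] //= _ _; lia.
- have sub : subseq [:: a; b; x] (w1 ++ a :: b :: w2).
    apply: subseq_trans (suffix_subseq w1 _).
    by apply: (@cat_subseq _ [:: a; b] [:: x] [:: a; b]); rewrite ?sub1seq.
  have [xlta | ax] := ltnP x a; [exists [:: 2; 3; 1] => //|
    have [xltb | bx] := ltnP x b; [exists [:: 1; 3; 2] => //|
                                   exists [:: 1; 2; 3] => //]];
  by apply: (subseq_contains _ _ _ sub) => // - [|[|[|r]]] [|[|[|s]]] //= _ _; lia.
Qed.

(** Some value among 1, 2, 3 differs from both letters of a given ascent; when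
    the ascent is adjacent, no letter lies between the two, so that value
    occurs on one side of both. *)
Lemma avoids_ascent_patterns_sorted (w : seq nat) :
    {subset [:: 1; 2; 3] <= w} -> all (avoids w) ascent_patterns ->
  sorted geq w.
Proof.
move=> sub123 av; apply/(sortedP 0) => i lti.
rewrite /= leqNgt; apply/negP => asc.
move: av; rewrite (all_predC (contains w)) => /negP; apply.
set a := nth 0 w i in asc *; set b := nth 0 w i.+1 in asc *.
have wE : w = take i w ++ a :: b :: drop i.+2 w.
  by rewrite -(drop_nth 0 lti) -(drop_nth 0 (ltnW lti)) cat_take_drop.
have /hasP[x x123 /andP[xa xb]] : has (fun x => (x != a) && (x != b)) [:: 1; 2; 3].
  by rewrite /=; lia.
have := sub123 _ x123; rewrite {1}wE mem_cat !inE (negPf xa) (negPf xb) /=.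
rewrite -mem_cat [X in contains X]wE.
exact: ascent_extends_to_pattern.
Qed.

Lemma mem_double_multiset (n i : nat) :
  0 < i <= n -> i \in double_multiset n.
Proof.
move=> ilen; apply/flatten_mapP; exists i; last by rewrite inE eqxx.
by rewrite mem_iota add1n ltnS.
Qed.

Theorem theorem2p19 (n : nat) (hn : 3 <= n) :
  c n [:: [:: 1; 2; 3]; [:: 1; 3; 2]; [:: 2; 1; 3]; [:: 2; 3; 1]; [:: 3; 1; 2]] = 1.
Proof.
have geq_total : total geq by move=> x y; apply: leq_total.
have geq_anti : antisymmetric geq.
  by move=> x y /=; rewrite -eqn_leq => /eqP.
pose w0 := sort geq (double_multiset n).
have w0_sorted : sorted geq w0 by apply: sort_sorted.
have w0_avoids sigma : ~~ sorted geq sigma -> avoids w0 sigma.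
  by apply: contra; apply: contains_nonincreasing.
rewrite /c /nonnesting count_filter.
rewrite (eq_in_count (a2 := pred1 w0)) => [|w].
  by rewrite count_uniq_mem ?permutations_uniq // mem_permutations perm_sort perm_refl.
rewrite mem_permutations => wP /=.
apply/idP/eqP => [/andP[av _] | ->]; last by rewrite !w0_avoids.
apply: (sorted_eq geq_trans geq_anti) => //; last first.
  by rewrite /w0 perm_sym perm_sort perm_sym.
apply: avoids_ascent_patterns_sorted => // x x123.
by rewrite (perm_mem wP) mem_double_multiset //; move: x123; rewrite !inE; lia.
Qed.
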